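(* Let $k\ge 0$ be an integer and let $\{\Delta_\epsilon\}_{\epsilon\in I}$ be a finite filtration of simplicial complexes on a finite set $X$. Then there exists a finite set $P$ of primes such that, for all primes $p\notin P$ and all $\epsilon\in I$, \[ H_k(\Delta_\epsilon;\mathbb{Z}_p)\cong\mathbb{Z}_p^{\beta_k(\Delta_\epsilon)} . \]
   Context: $\mathbb{Z}_p=\mathbb{Z}/p\mathbb{Z}$. $I$ is an interval of $\mathbb{R}$. A filtration of a finite set $X$ is a family $\{\Delta_\epsilon\}_{\epsilon\in I}$ of simplicial complexes with vertices in $X$ (subcomplexes of the full simplex on $X$) such that $\Delta_\epsilon\subseteq\Delta_{\epsilon'}$ whenever $\epsilon\le\epsilon'$. It is finite in the sense that it is determined by finitely many stages, i.e. only finitely many distinct complexes occur among the $\Delta_\epsilon$. $H_k(\Delta;G)$ denotes simplicial homology with coefficients in $G$, and $\beta_k(\Delta)$ is the $k$-th Betti number, i.e. the rank of the finitely generated abelian group $H_k(\Delta;\mathbb{Z})$. *)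

(* Defs.v *)
From HB Require Import structures.
From mathcomp Require Import all_classical all_reals.
From mathcomp.analysis Require Import normedtype.
From mathcomp Require Import all_boot all_order all_algebra.

Set Implicit Arguments.
Unset Strict Implicit.
Unset Printing Implicit Defensive.

Import Order.TTheory GRing.Theory Num.Theory.
Local Open Scope ring_scope.

(* The empty set is not a simplex, so the homology below is unreduced.  Not   *)
(* every point of X has to be a vertex.                                       *)
Record complex (X : finType) := Complex {
  faces :> {set {set X}};
  set0_notin_faces : set0 \notin faces;
  faces_closed : forall s t : {set X},
    s \in faces -> t \subset s -> t != set0 -> t \in faces
}.

Section Chains.
Variables (X : finType) (D : complex X) (G : zmodType).

(* Simplices and chains are indexed by the number n of vertices, that is by   *)
(* the dimension plus one; chain 0 is the zero group.                         *)
Definition simplex (n : nat) := {s : {set X} | (s \in faces D) && (#|s| == n)}.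

Definition chain (n : nat) := {ffun simplex n -> G}.

HB.instance Definition _ n := GRing.Zmodule.on (chain n).

(* Simplices are oriented by the enumeration order of X: x is the vertex      *)
(* number (position s x) of s.                                                *)
Definition position (s : {set X}) (x : X) : nat :=
  #|[set y in s | (enum_rank y < enum_rank x)%N]|.

(* d [x_0, ..., x_n] = \sum_i (-1)^i [x_0, ..., x_(i-1), x_(i+1), ..., x_n],  *)
(* read off at the coefficient of t.                                          *)
Definition boundary n (c : chain n.+1) : chain n :=
  [ffun t : simplex n => \sum_(s : simplex n.+1)
     \sum_(x in val s | val s :\ x == val t) c s *~ (-1) ^+ position (val s) x].

Fact boundary_is_zmod_morphism n : zmod_morphism (@boundary n).
Proof.
move=> a b; apply/ffunP => t; rewrite !ffunE -sumrB; apply: eq_bigr => s _.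
by rewrite -sumrB; apply: eq_bigr => x _; rewrite !ffunE mulrzBl.
Qed.

HB.instance Definition _ n :=
  GRing.isZmodMorphism.Build (chain n.+1) (chain n) (@boundary n)
    (@boundary_is_zmod_morphism n).

Variable k : nat.

Definition is_cycle : {pred chain k.+1} := [pred c | boundary c == 0].

Fact is_cycle_zmod_closed : zmod_closed is_cycle.
Proof.
split=> [|a b]; rewrite !inE ?raddf0 // => /eqP a0 /eqP b0.
by rewrite boundary_is_zmod_morphism a0 b0 subr0.
Qed.

HB.instance Definition _ :=
  GRing.isZmodClosed.Build (chain k.+1) is_cycle is_cycle_zmod_closed.

Record cycle := Cycle { cycle_chain :> chain k.+1; _ : cycle_chain \in is_cycle }.

HB.instance Definition _ := [isSub for cycle_chain].
HB.instance Definition _ := [Choice of cycle by <:].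
HB.instance Definition _ := [SubChoice_isSubZmodule of cycle by <:].

Definition is_boundary : {pred cycle} :=
  [pred z : cycle | `[< exists c : chain k.+2, boundary c = z >]].

Fact is_boundary_zmod_closed : zmod_closed is_boundary.
Proof.
split=> [|a b]; rewrite !inE; first by apply/asboolP; exists 0; rewrite !raddf0.
move=> /asboolP[c ca] /asboolP[d db]; apply/asboolP.
by exists (c - d); rewrite !raddfB /= ca db.
Qed.

HB.instance Definition _ :=
  GRing.isZmodClosed.Build cycle is_boundary is_boundary_zmod_closed.

Definition homology : zmodType := Quotient.quot is_boundary.

End Chains.

Definition group_isomorphic (A B : zmodType) : Prop :=
  exists f : {additive A -> B}, bijective f.

Definition zindependent (A : zmodType) (r : nat) (v : 'I_r -> A) : Prop :=
  forall a : 'I_r -> int, \sum_i v i *~ a i = 0 -> forall i, a i = 0.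

(* The largest size of a Z-independent family, and a junk value if there is   *)
(* none, which does not happen for a finitely generated group.                *)
Definition zrank (A : zmodType) : nat :=
  [get r : nat | (exists v : 'I_r -> A, zindependent v) /\
     forall (m : nat) (v : 'I_m -> A), zindependent v -> (m <= r)%N].

Definition betti (X : finType) (k : nat) (D : complex X) : nat :=
  zrank (homology D int k).

(* Only the values of Delta on I matter. *)
Definition finite_filtration (R : realType) (X : finType) (I : set R)
    (Delta : R -> complex X) : Prop :=
  (forall e e' : R, I e -> I e' -> e <= e' ->
     faces (Delta e) \subset faces (Delta e')) /\
  finite_set [set faces (Delta e) | e in I]%classic.

(* Main.v *)
From HB Require Import structures.
Require Import Defs.
From mathcomp Require Import all_classical all_reals.
From mathcomp.analysis Require Import normedtype.
From mathcomp Require Import all_boot all_order all_algebra finmap.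

Set Implicit Arguments.
Unset Strict Implicit.
Unset Printing Implicit Defensive.

Import Order.TTheory GRing.Theory Num.Theory.
Local Open Scope ring_scope.

(** The chain complexes of Delta with coefficients in Z, Q and F_p all come from
    the same integer boundary matrices.  An integer matrix has the same rank
    over F_p as over Q unless p divides one of its nonzero elementary divisors
    (Smith normal form), so for all but finitely many p the homology over F_p
    has the same dimension as the homology over Q: this is [rank_mod_p] and its
    consequence [homology_dim_mod_p].

    It remains to recognise both dimensions.  Over a field, homology is a vector
    space, hence isomorphic to a space of row vectors of that dimension
    ([presented_dim]).  Over Z, the rank of the homology is its dimension over
    Q: clearing denominators turns a rational basis into a Z-independent family
    of integral classes, and a rational relation into an integral one
    ([presented_zrank]).

    This gives a finite set of bad primes for one complex.  As X is finite it
    carries only finitely many complexes, so one finite set of primes serves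
    for all of them ([homology_mod_p_uniform]), and in particular for all stages
    of a filtration. *)

(** * Ranks of integer matrices modulo a prime *)

Local Notation mx_over F M := (map_mx (intmul (1 : F)) M).

Lemma map_intr_unitmx (F : fieldType) n (L : 'M[int]_n) :
  L \in unitmx -> mx_over F L \in unitmx.
Proof. by rewrite !unitmxE det_map_mx; apply: rmorph_unit. Qed.

Lemma map_intr_mx_inj m n : injective (fun M : 'M[int]_(m, n) => mx_over rat M).
Proof.
move=> M1 M2 /matrixP eqM; apply/matrixP => i j.
by have := eqM i j; rewrite !mxE => /intr_inj.
Qed.

(** The Smith normal form rewritten as a product in which only [diag_mx e] can
    degenerate modulo a prime: its zero entries are moved to [pid_mx r], whose
    rank is [r] over every field. *)
Lemma smith_factorization m n (M : 'M[int]_(m, n)) :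
  exists L : 'M[int]_m, exists R : 'M[int]_n, exists e : 'rV[int]_m,
  exists r : nat,
    [/\ L \in unitmx, R \in unitmx, forall i, e 0 i != 0, (r <= minn m n)%N
      & M = L *m diag_mx e *m pid_mx r *m R].
Proof.
have [L uL [R uR [d d_sorted ->]]] := int_Smith_normal_form M.
(* As 0 divides only 0, the divisibility chain d is zero from its first zero
   on; past its end the default value 0 agrees with this. *)
have nz_prefix i : (d`_i == 0) = (find (pred1 (0 : int)) d <= i)%N.
  case: (ltnP i (find (pred1 (0 : int)) d)) => [/(before_find 0) //|le_i].
  have [sz_i|i_lt] := leqP (size d) i; first by rewrite nth_default ?eqxx.
  have has0 : has (pred1 (0 : int)) d by rewrite has_find (leq_ltn_trans le_i).
  have := sorted_leq_nth dvdz_trans dvdzz 0 d_sorted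
            (find (pred1 (0 : int)) d) i.
  rewrite !inE -has_find has0 i_lt => /(_ isT isT le_i).
  by rewrite (eqP (nth_find 0 has0)) dvd0z.
pose r := minn (find (pred1 (0 : int)) d) (minn m n).
exists L, R, (\row_i (if d`_i == 0 then 1 else d`_i)), r; split=> //.
- by move=> i; rewrite mxE; case: ifP => [_|/negbT].
- exact: geq_minr.
- congr (_ *m _); rewrite -mulmxA; congr (_ *m _).
  apply/matrixP => i j; rewrite mul_diag_mx !mxE.
  case: (eqVneq (i : nat) j) => [ij|]; rewrite ?mulr0 //=.
  rewrite !leq_min ltn_ord ij ltn_ord !andbT nz_prefix ltnNge.
  have := nz_prefix j.
  by case: leqP => _; rewrite ?mulr1 ?mulr0 // => /eqP.
Qed.

(** By [smith_factorization] the rank is [r] over every field in which the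
    product of the [e 0 i] is nonzero, so that product can serve as [N]. *)
Lemma rank_mod_p m n (M : 'M[int]_(m, n)) :
  exists2 N : nat, (0 < N)%N & forall p, prime p -> ~~ (p %| N)%N ->
    \rank (mx_over 'F_p M) = \rank (mx_over rat M).
Proof.
have [L [R [e [r [uL uR nz_e]]]]] := smith_factorization M.
rewrite leq_min => /andP[le_rm le_rn] defM.
pose N := \prod_i e 0 i.
have nzN : N != 0 by apply/prodf_neq0.
have rankE (F : fieldType) : N%:~R != 0 :> F -> \rank (mx_over F M) = r.
  move=> nzNF; rewrite defM !map_mxM map_pid_mx /=.
  rewrite mxrankMfree ?row_free_unit ?map_intr_unitmx //.
  rewrite eqmxMfull ?rank_pid_mx // row_full_unit unitmx_mul.
  by rewrite map_intr_unitmx //= unitmxE det_map_mx det_diag unitfE.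
exists `|N|%N; first by rewrite absz_gt0.
move=> p p_pr Np; rewrite !rankE ?intr_eq0 //.
by rewrite -(dvdz_pcharf (pchar_Fp p_pr)).
Qed.

(** * Homology of a pair of matrices over a field *)

(** Vectors are rows, so [A] followed by [B] is [v |-> v *m A *m B], and this is
    the dimension of ker B / (ker B :&: im A), computed on a complement. *)
Definition homology_dim (F : fieldType) a n b
    (A : 'M[F]_(a, n)) (B : 'M[F]_(n, b)) : nat := \rank (kermx B :\: A)%MS.

(** The point of this formula is that it involves ranks of products of [A] and
    [B] only, so that it can be compared across fields. *)
Lemma homology_dimE (F : fieldType) a n b
    (A : 'M[F]_(a, n)) (B : 'M[F]_(n, b)) :
  homology_dim A B = (n - \rank B - (\rank A - \rank (A *m B)))%N.
Proof.
rewrite -(mxrank_mul_ker A B) addKn -mxrank_ker.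
by rewrite -(mxrank_cap_compl (kermx B) A) capmxC addKn.
Qed.

Lemma homology_dim_mod_p a n b (A : 'M[int]_(a, n)) (B : 'M[int]_(n, b)) :
  exists2 N : nat, (0 < N)%N & forall p, prime p -> ~~ (p %| N)%N ->
    homology_dim (mx_over 'F_p A) (mx_over 'F_p B) =
    homology_dim (mx_over rat A) (mx_over rat B).
Proof.
have [NA NA0 rkA] := rank_mod_p A.
have [NB NB0 rkB] := rank_mod_p B.
have [NC NC0 rkC] := rank_mod_p (A *m B).
exists (NA * NB * NC)%N; first by rewrite !muln_gt0 NA0 NB0.
move=> p p_pr; rewrite !Euclid_dvdM // !negb_or => /andP[/andP[pA pB] pC].
by rewrite !homology_dimE -!map_mxM rkA ?rkB ?rkC.
Qed.

(** [Phi] reads off the coordinates of a homology class and the rows of [W] are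
    cycles whose classes form the corresponding basis.  [W] is a basis of a
    complement of ker B :&: im A in ker B, and [Phi] is the projection onto that
    complement followed by coordinates in [W]. *)
Lemma homology_coordinates (F : fieldType) a n b
    (A : 'M[F]_(a, n)) (B : 'M[F]_(n, b)) (h := homology_dim A B) :
  exists Phi : 'M[F]_(n, h), exists W : 'M[F]_(h, n),
    [/\ W *m B = 0, W *m Phi = 1%:M
      & forall m (z : 'M_(m, n)), z *m B = 0 -> (z *m Phi == 0) = (z <= A)%MS].
Proof.
set K := kermx B; pose U := (K :\: A)%MS; pose V := (K :&: A)%MS.
have UV0 : (U :&: V = 0)%MS.
  by apply/eqP; rewrite -submx0 -(capmx_diff K A) capmxS ?capmxSr.
pose W := row_base U.
exists (proj_mx U V *m pinvmx W), W; split=> [||m z zB].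
- by apply/sub_kermxP; rewrite eq_row_base diffmxSl.
- by rewrite mulmxA proj_mx_id ?eq_row_base // mulmxVp ?row_base_free.
have zUV : (z <= U + V)%MS by rewrite addsmx_diff_cap_eq; apply/sub_kermxP.
rewrite mulmxA; apply/eqP/idP => [z0|zA].
  rewrite -(add_proj_mx UV0 zUV).
  have zPW : (z *m proj_mx U V <= W)%MS by rewrite eq_row_base proj_mx_sub.
  rewrite -(mulmxKpV zPW) z0 mul0mx add0r.
  by apply: submx_trans (capmxSr K A); apply: proj_mx_sub.
by rewrite proj_mx_0 ?mul0mx // sub_capmx zA andbT; apply/sub_kermxP.
Qed.

Lemma clear_denominators m n (M : 'M[rat]_(m, n)) :
  exists2 N : int, N != 0 & exists M' : 'M[int]_(m, n),
    N%:~R *: M = mx_over rat M'.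
Proof.
pose N := \prod_i \prod_j denq (M i j).
exists N.
  by apply/prodf_neq0 => i _; apply/prodf_neq0 => j _; apply: denq_neq0.
(* c i j is N with its factor denq (M i j) left out. *)
pose c i j : int := (\prod_(j' | j' != j) denq (M i j')) *
                    (\prod_(i' | i' != i) \prod_j' denq (M i' j')).
exists (\matrix_(i, j) (numq (M i j) * c i j)).
apply/matrixP => i j; rewrite !mxE.
rewrite /N (bigD1 i) //= (bigD1 j) //= -mulrA -/(c i j) !rmorphM /= mulrAC.
by congr (_ * _); rewrite mulrC -numqE.
Qed.

(** * Groups presented as the homology of a pair of matrices *)

(** [cls] is constrained only on the cycles [v *m B = 0], where it behaves as
    the projection of ker B onto ker B / (ker B :&: im A); making it total
    avoids a subtype of cycles. *)
Definition presents_homology (R : pzRingType) a n b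
    (A : 'M[R]_(a, n)) (B : 'M[R]_(n, b)) (H : zmodType)
    (cls : 'rV[R]_n -> H) : Prop :=
  [/\ forall x, exists2 v, v *m B = 0 & cls v = x,
      forall v w, v *m B = 0 -> w *m B = 0 -> cls (v - w) = cls v - cls w
    & forall v, v *m B = 0 -> (cls v = 0 <-> exists y, v = y *m A)].

(** The coordinates [Phi] of [homology_coordinates] descend to [H], through any
    choice [rep] of representing cycles, with inverse [w |-> cls (w *m W)]. *)
Lemma presented_dim (F : fieldType) a n b
    (A : 'M[F]_(a, n)) (B : 'M[F]_(n, b)) (H : zmodType) (cls : 'rV[F]_n -> H) :
  presents_homology A B cls -> group_isomorphic H 'rV[F]_(homology_dim A B).
Proof.
move=> [cls_surj clsB cls0].
have [Phi [W [WB WPhi kerPhi]]] := homology_coordinates A B.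
have eq_cls v w : v *m B = 0 -> w *m B = 0 ->
    (cls v = cls w) <-> (v *m Phi = w *m Phi).
  move=> vB wB; have vwB : (v - w) *m B = 0 by rewrite mulmxBl vB wB subr0.
  split=> eq_vw; apply/eqP; rewrite -subr_eq0.
    rewrite -mulmxBl kerPhi //; apply/submxP/(cls0 _ vwB).
    by rewrite clsB // eq_vw subrr.
  rewrite -clsB //; apply/eqP/(cls0 _ vwB)/submxP.
  by rewrite -kerPhi // mulmxBl eq_vw subrr.
have [rep repP] : {rep : H -> 'rV[F]_n &
    forall x, rep x *m B = 0 /\ cls (rep x) = x}.
  by apply: (@choice _ _ (fun x v => v *m B = 0 /\ cls v = x)) => x;
    have [v ? ?] := cls_surj x; exists v.
have repB x : rep x *m B = 0 by case: (repP x).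
have repK x : cls (rep x) = x by case: (repP x).
pose f x := rep x *m Phi.
have f_additive : zmod_morphism f.
  move=> x y; rewrite /f -mulmxBl; apply/eq_cls; rewrite ?repB //.
    by rewrite mulmxBl !repB subr0.
  by rewrite clsB ?repK.
pose f_morph :=
  GRing.isZmodMorphism.Build H 'rV[F]_(homology_dim A B) f f_additive.
pose f_add : {additive H -> 'rV[F]_(homology_dim A B)} := HB.pack f f_morph.
exists f_add.
have wWB (w : 'rV_(homology_dim A B)) : w *m W *m B = 0.
  by rewrite -mulmxA WB mulmx0.
exists (fun w => cls (w *m W)) => [x|w] /=; rewrite /f.
  rewrite -{2}[x]repK; apply/eq_cls; rewrite ?wWB ?repB //.
  by rewrite -mulmxA WPhi mulmx1.
by rewrite -[RHS]mulmx1 -WPhi mulmxA; apply/eq_cls; rewrite ?wWB ?repB.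
Qed.

Lemma zrankE (A : zmodType) r :
    (exists v : 'I_r -> A, zindependent v) ->
    (forall m (v : 'I_m -> A), zindependent v -> (m <= r)%N) ->
  zrank A = r.
Proof.
move=> indep_r max_r.
apply: get_unique => [//|m [[v indep_v] max_m]].
have [w indep_w] := indep_r.
by apply/eqP; rewrite eqn_leq (max_r _ _ indep_v) (max_m _ _ indep_w).
Qed.

Lemma presented_sum a n b (A : 'M[int]_(a, n)) (B : 'M[int]_(n, b))
    (H : zmodType) (cls : 'rV[int]_n -> H) :
  presents_homology A B cls -> forall m (Z : 'M[int]_(m, n)) (c : 'rV[int]_m),
  Z *m B = 0 -> cls (c *m Z) = \sum_i cls (row i Z) *~ c 0 i.
Proof.
move=> [_ clsB _] m Z c ZB.
have cls0 : cls 0 = 0.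
  by have := clsB 0 0 (mul0mx _ _) (mul0mx _ _); rewrite subr0 subrr.
have clsN w : w *m B = 0 -> cls (- w) = - cls w.
  by move=> wB; rewrite -[- w]sub0r clsB ?mul0mx // cls0 sub0r.
have clsD v w : v *m B = 0 -> w *m B = 0 -> cls (v + w) = cls v + cls w.
  by move=> vB wB; rewrite -[w]opprK clsB ?mulNmx ?wB ?oppr0 // clsN // !opprK.
have clsMn v k : v *m B = 0 -> cls (v *+ k) = cls v *+ k.
  move=> vB; elim: k => [|k IHk]; rewrite ?mulr0n // !mulrS clsD ?IHk //.
  by rewrite -scaler_nat -scalemxAl vB scaler0.
have clsMz v (k : int) : v *m B = 0 -> cls (v *~ k) = cls v *~ k.
  move=> vB; case: k => k; first exact: clsMn.
  rewrite !NegzE !mulrNz -[LHS]/(cls (- (v *+ k.+1))) clsN ?clsMn //.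
  by rewrite -scaler_nat -scalemxAl vB scaler0.
rewrite mulmx_sum_row.
have rowB i : row i Z *m B = 0 by rewrite -row_mul ZB row0.
suff [_ //] : (\sum_i c 0 i *: row i Z) *m B = 0 /\
    cls (\sum_i c 0 i *: row i Z) = \sum_i cls (row i Z) *~ c 0 i.
(* cls is additive on cycles only, so the induction carries along that the
   partial sums are cycles. *)
apply: (big_ind2 (fun v x => v *m B = 0 /\ cls v = x))
  => [|v x w y [vB <-] [wB <-]|i _].
- by rewrite mul0mx.
- by rewrite mulmxDl vB wB addr0 clsD.
- rewrite -scalemxAl rowB scaler0; split=> //.
  by rewrite -{1}[c 0 i]intz scaler_int clsMz.
Qed.

(** Rationalisation: by [cls0_Phi] and [Phi_cls0] below, the rational
    coordinates of an integral cycle vanish exactly when its class is torsion.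
    So the rows of [W], scaled to integral cycles by a common denominator, give
    a Z-independent family, while more classes than the rational dimension have a
    rational relation among their coordinates and therefore an integral one. *)
Lemma presented_zrank a n b (A : 'M[int]_(a, n)) (B : 'M[int]_(n, b))
    (H : zmodType) (cls : 'rV[int]_n -> H) :
  presents_homology A B cls ->
  zrank H = homology_dim (mx_over rat A) (mx_over rat B).
Proof.
move=> presH; have cls_sum := presented_sum presH.
case: presH => cls_surj _ cls0.
have [Phi [W [WB WPhi kerPhi]]] :=
  homology_coordinates (mx_over rat A) (mx_over rat B).
have ratB v : v *m B = 0 -> mx_over rat v *m mx_over rat B = 0.
  by move=> vB; rewrite -map_mxM vB map_mx0.
have cls0_Phi (v : 'rV_n) : v *m B = 0 -> cls v = 0 -> mx_over rat v *m Phi = 0.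
  move=> vB /(cls0 _ vB)[y vE]; apply/eqP.
  by rewrite kerPhi ?ratB // vE map_mxM submxMl.
have Phi_cls0 (v : 'rV_n) : v *m B = 0 -> mx_over rat v *m Phi = 0 ->
    exists2 N : int, N != 0 & cls (N *: v) = 0.
  move=> vB /eqP; rewrite kerPhi ?ratB // => /submxP[y vE].
  have [N nzN [y' y'E]] := clear_denominators y.
  exists N => //; apply/cls0; first by rewrite -scalemxAl vB scaler0.
  exists y'; apply: map_intr_mx_inj.
  by rewrite map_mxZ map_mxM -y'E -scalemxAl -vE.
apply: zrankE.
  have [N nzN [W' W'E]] := clear_denominators W.
  have W'B : W' *m B = 0.
    apply: map_intr_mx_inj.
    by rewrite map_mxM -W'E -scalemxAl WB scaler0 map_mx0.
  exists (fun i => cls (row i W')) => c sum0 i.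
  pose r := \row_i c i.
  have : mx_over rat (r *m W') *m Phi = 0.
    apply: cls0_Phi; first by rewrite -mulmxA W'B mulmx0.
    by rewrite cls_sum // -[RHS]sum0; apply: eq_bigr => j _; rewrite mxE.
  rewrite map_mxM -W'E -scalemxAr -scalemxAl -mulmxA WPhi mulmx1.
  move/rowP/(_ i); rewrite !mxE => /eqP.
  by rewrite mulf_eq0 !intr_eq0 (negPf nzN) => /eqP.
move=> m v indep_v; rewrite leqNgt; apply/negP => lt_m.
have [z zP] : {z : 'I_m -> 'rV[int]_n &
    forall i, z i *m B = 0 /\ cls (z i) = v i}.
  by apply: (@choice _ _ (fun i z => z *m B = 0 /\ cls z = v i)) => i;
    have [z ? ?] := cls_surj (v i); exists z.
pose Z := \matrix_i z i.
have ZB : Z *m B = 0.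
  by apply/row_matrixP => i; rewrite row_mul rowK row0; case: (zP i).
have /rowV0Pn[u /sub_kermxP uZ nz_u] : kermx (mx_over rat Z *m Phi) != 0.
  rewrite kermx_eq0 -row_leq_rank -ltnNge.
  exact: leq_ltn_trans (rank_leq_col _) lt_m.
have [N nzN [u' u'E]] := clear_denominators u.
have [N' nzN' N'0] : exists2 N' : int, N' != 0 & cls (N' *: (u' *m Z)) = 0.
  apply: Phi_cls0; first by rewrite -mulmxA ZB mulmx0.
  by rewrite map_mxM -u'E -mulmxA -scalemxAl uZ scaler0.
have sum0 : \sum_i v i *~ (N' *: u') 0 i = 0.
  rewrite -[RHS]N'0 scalemxAl cls_sum //; apply: eq_bigr => i _.
  by rewrite rowK; case: (zP i) => _ ->.
have u'0 : u' = 0.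
  apply/rowP => i; have /eqP := indep_v _ sum0 i.
  by rewrite !mxE mulf_eq0 (negPf nzN') => /eqP.
move: u'E; rewrite u'0 map_mx0 => /eqP.
by rewrite scaler_eq0 intr_eq0 (negPf nzN) (negPf nz_u).
Qed.

(** * Simplicial homology in terms of boundary matrices *)

Section ChainRows.
Variables (X : finType) (D : complex X).

Definition incidence n (s : simplex D n.+1) (t : simplex D n) : int :=
  \sum_(x in val s | val s :\ x == val t) (-1) ^+ position (val s) x.

Definition boundary_mx n :
    'M[int]_(#|{: simplex D n.+1}|, #|{: simplex D n}|) :=
  \matrix_(i, j) incidence (enum_val i) (enum_val j).

Variable R : nzRingType.

Definition chain_row n (c : chain D R n) : 'rV[R]_(#|{: simplex D n}|) :=
  \row_i c (enum_val i).

Definition row_chain n (v : 'rV[R]_(#|{: simplex D n}|)) : chain D R n :=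
  [ffun s => v 0 (enum_rank s)].

Lemma row_chainK n : cancel (@row_chain n) (@chain_row n).
Proof. by move=> v; apply/rowP => i; rewrite !mxE ffunE enum_valK. Qed.

Lemma chain_rowK n : cancel (@chain_row n) (@row_chain n).
Proof. by move=> c; apply/ffunP => s; rewrite ffunE mxE enum_rankK. Qed.

Lemma row_chainB n : {morph @row_chain n : v w / v - w}.
Proof. by move=> v w; apply/ffunP => s; rewrite !ffunE !mxE. Qed.

Lemma row_chain0 n : @row_chain n 0 = 0.
Proof. by apply/ffunP => s; rewrite !ffunE mxE. Qed.

Lemma chain_row_boundary n (c : chain D R n.+1) :
  chain_row (boundary c) = chain_row c *m mx_over R (boundary_mx n).
Proof.
apply/rowP => j; rewrite !mxE ffunE.
rewrite (reindex (@enum_val _ (mem {: simplex D n.+1}))) /=; last first.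
  by exists enum_rank => s _; rewrite ?enum_valK ?enum_rankK.
apply: eq_bigr => i _; rewrite !mxE rmorph_sum mulr_sumr.
by apply: eq_bigr => x _; rewrite mulrzr.
Qed.

Lemma boundary_row_chain n (v : 'rV[R]_(#|{: simplex D n.+1}|)) :
  boundary (row_chain v) = row_chain (v *m mx_over R (boundary_mx n)).
Proof.
apply: (can_inj (@chain_rowK n)).
by rewrite chain_row_boundary !row_chainK.
Qed.

Lemma homology_presented k : exists cls,
  presents_homology (mx_over R (boundary_mx k.+1)) (mx_over R (boundary_mx k))
    (cls : _ -> homology D R k).
Proof.
pose piH : Defs.cycle D R k -> homology D R k :=
  \pi_(Quotient.quot (@is_boundary X D R k))%qT.
have piHB z w : piH (z - w) = piH z - piH w by exact: raddfB.
have piH0 z : piH z = 0 <-> exists c, boundary c = z :> chain D R k.+1.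
  split=> [z0|bd_z].
    have : z - 0 \in @is_boundary X D R k.
      by rewrite Quotient.idealrBE -/(piH z) -/(piH 0) z0 [piH 0]raddf0.
    by rewrite subr0 inE => /asboolP.
  have -> : 0 = piH 0 by rewrite [piH 0]raddf0.
  apply/eqP; rewrite -[_ == _]Quotient.idealrBE subr0 inE; exact/asboolP.
pose cyc v : Defs.cycle D R k := insubd 0 (row_chain v).
have cycE v : v *m mx_over R (boundary_mx k) = 0 ->
    cycle_chain (cyc v) = row_chain v.
  move=> vB.
  by rewrite [LHS]val_insubd inE boundary_row_chain vB row_chain0 eqxx.
exists (piH \o cyc); split=> [x|v w vB wB|v vB] /=.
- pose z := repr x; exists (chain_row z).
    rewrite -chain_row_boundary.
    have := valP z; rewrite inE => /eqP ->.
    by apply/rowP=> i; rewrite !mxE ffunE.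
  suff -> : cyc (chain_row z) = z by apply: reprK.
  by apply: val_inj; rewrite /= val_insubd chain_rowK (valP z).
- rewrite -piHB; congr piH; apply: val_inj.
  rewrite [RHS](raddfB val) /= !cycE ?row_chainB //.
  by rewrite mulmxBl vB wB subr0.
- rewrite piH0 cycE //; split=> [[c cE]|[y ->]].
    by exists (chain_row c); rewrite -chain_row_boundary cE row_chainK.
  by exists (row_chain y); rewrite boundary_row_chain.
Qed.
End ChainRows.

(** * Comparison of the Betti numbers *)

Lemma homology_mod_p (X : finType) (D : complex X) (k : nat) :
  exists2 N : nat, (0 < N)%N & forall p, prime p -> ~~ (p %| N)%N ->
    group_isomorphic (homology D 'Z_p k) 'rV['Z_p]_(betti k D).
Proof.
have [N N_gt0 dimE] :=
  homology_dim_mod_p (boundary_mx D k.+1) (boundary_mx D k).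
exists N => // p p_pr Np.
have [clsZ presZ] := homology_presented D int k.
have [clsp presp] := homology_presented D 'F_p k.
have := presented_dim presp.
rewrite dimE // -(presented_zrank (cls := clsZ)).
  (* The field 'F_p is by definition 'Z_q for q := pdiv p; as p is prime,
     q = p. *)
  suff change_modulus q : q = p ->
      group_isomorphic (homology D 'Z_q k) 'rV['Z_q]_(betti k D) ->
      group_isomorphic (homology D 'Z_p k) 'rV['Z_p]_(betti k D).
    by apply: change_modulus; apply: pdiv_id.
  by move->.
have intE m n (M : 'M[int]_(m, n)) : mx_over int M = M.
  by apply/matrixP => i j; rewrite mxE intz.
by rewrite -[boundary_mx D k.+1]intE -[boundary_mx D k]intE.
Qed.

Lemma complex_faces_inj (X : finType) : injective (@faces X).
Proof.
move=> [F1 F1_0 F1_closed] [F2 F2_0 F2_closed] /= eqF.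
by subst F2; congr Complex; apply: Prop_irrelevance.
Qed.

(** The complexes on [X] are determined by their sets of faces, which range over
    a finite type; the product of the bounds for the individual complexes
    excludes the bad primes of all of them. *)
Lemma homology_mod_p_uniform (X : finType) (k : nat) :
  exists2 N : nat, (0 < N)%N & forall p, prime p -> ~~ (p %| N)%N ->
    forall D : complex X,
    group_isomorphic (homology D 'Z_p k) 'rV['Z_p]_(betti k D).
Proof.
have [N NP] : {N : {set {set X}} -> nat & forall S, (0 < N S)%N /\
    forall D : complex X, faces D = S -> forall p, prime p -> ~~ (p %| N S)%N ->
    group_isomorphic (homology D 'Z_p k) 'rV['Z_p]_(betti k D)}.
  apply: (@choice _ _ (fun S N => (0 < N)%N /\
    forall D : complex X, faces D = S -> forall p, prime p -> ~~ (p %| N)%N ->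
    group_isomorphic (homology D 'Z_p k) 'rV['Z_p]_(betti k D))) => S.
  have [[D <-]|noD] := pselect (exists D : complex X, faces D = S).
    have [N N_gt0 NP] := homology_mod_p D k.
    by exists N; split=> // D' /complex_faces_inj ->.
  by exists 1%N; split=> // D DS; case: noD; exists D.
exists (\prod_S N S)%N; first by rewrite prodn_gt0 // => S; case: (NP S).
move=> p p_pr pN D; have [_ /(_ D erefl p p_pr)] := NP (faces D).
apply; apply: contra pN => /dvdn_trans; apply.
by rewrite (bigD1 (faces D)) //= dvdn_mulr.
Qed.

Theorem corollary4p1 (R : realType) (I : set R) (X : finType) (k : nat)
    (Delta : R -> complex X) :
  is_interval I ->
  finite_filtration I Delta ->
  exists P : {fset nat},
    (forall p : nat, p \in P -> prime p) /\
    (forall p : nat, prime p -> p \notin P -> forall e : R, I e ->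
       group_isomorphic (homology (Delta e) 'Z_p k)
                        'rV['Z_p]_(betti k (Delta e))).
Proof.
move=> _ _; have [N N_gt0 NP] := homology_mod_p_uniform X k.
exists [fset p | p in primes N]%fset; split=> p.
  by rewrite !inE /= mem_primes => /and3P[].
rewrite !inE /= mem_primes N_gt0 /= => p_pr; rewrite p_pr /= => pN e _.
exact: NP.
Qed.
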